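(* Let $N\ge 1$, let $Q,B$ be real $N\times N$ matrices with $Q=Q^\star\ge 0$ such that $K(t)$ is invertible for every $t>0$. If $\max\{\Re(\lambda)\mid\lambda\in\sigma(B)\}\ge 0$, then there exists a constant $c_0>0$ such that $$V(t)\ge c_0\sqrt t\quad\text{for all }t\ge 1.$$ If instead $\max\{\Re(\lambda)\mid\lambda\in\sigma(B)\}<0$, then as $t\nearrow\infty$ we have $$tK(t)\nearrow K_\infty:=\int_0^\infty e^{sB}Qe^{sB^\star}\,ds<\infty,$$ i.e. the integral defining $K_\infty$ is finite and $tK(t)$ converges to $K_\infty$, monotonically increasing in the sense of symmetric matrices.
   Context: $K(t)=\frac1t\int_0^te^{sB}Qe^{sB^\star}\,ds$ for $t>0$ ($^\star$ denotes transpose). $\sigma(B)\subset\mathbb C$ is the spectrum of $B$. The volume function is $V(t)=\omega_N\big(\det(tK(t))\big)^{1/2}$, where $\omega_N$ is the Lebesgue measure of the unit ball of $\mathbb R^N$. No sign condition on $\operatorname{tr}B$ is assumed. *)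

(* Defs.v *)
From HB Require Import structures.
From mathcomp Require Import all_boot all_order all_algebra.
From mathcomp Require Import all_classical all_reals all_analysis.
From mathcomp Require Import complex.

Set Implicit Arguments.
Unset Strict Implicit.
Unset Printing Implicit Defensive.

Import Order.TTheory GRing.Theory Num.Theory.
Import numFieldTopology.Exports numFieldNormedType.Exports.

Local Open Scope classical_set_scope.
Local Open Scope ring_scope.

Definition spectrum (R : realType) (N : nat) (B : 'M[R]_N) : set R[i] :=
  [set lambda | eigenvalue (map_mx (real_complex R) B) lambda].

(* For N > 0 this supremum is a maximum, see spectral_abscissa_max. *)
Definition spectral_abscissa (R : realType) (N : nat) (B : 'M[R]_N) : R :=
  sup [set complex.Re lambda | lambda in spectrum B].

Lemma spectrumE (R : realType) (N : nat) (B : 'M[R]_N) :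
  exists r : seq R[i],
    size r = N /\ spectrum B = [set lambda | lambda \in r].
Proof.
set A := map_mx (real_complex R) B.
have [r Er] := closed_field_poly_normal (char_poly A).
move: Er; rewrite (monicP (char_poly_monic A)) scale1r => Er.
exists r; split.
  by apply/succn_inj; rewrite -(size_char_poly A) Er size_prod_XsubC.
apply/seteqP; split => l /=; rewrite /spectrum /= eigenvalue_root_char.
  by rewrite -/A Er root_prod_XsubC.
by rewrite -/A Er root_prod_XsubC.
Qed.

Lemma seq_max_ex (R : realType) (s : seq R) : (0 < size s)%N ->
  exists2 m, m \in s & forall x, x \in s -> x <= m.
Proof.
elim: s => // a [|b s] IH _.
  by exists a; rewrite ?mem_head// => x; rewrite inE => /eqP ->.
have [//|m ms mP] := IH.
have [am|ma] := leP a m.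
  exists m; first by rewrite inE ms orbT.
  by move=> x; rewrite inE => /orP[/eqP->//|/mP].
exists a; rewrite ?mem_head// => x; rewrite inE => /orP[/eqP->//|/mP xm].
exact: le_trans xm (ltW ma).
Qed.

Lemma spectral_abscissa_max (R : realType) (N : nat) (B : 'M[R]_N) :
  (0 < N)%N ->
  (exists2 lambda, spectrum B lambda & complex.Re lambda = spectral_abscissa B)
  /\ forall lambda, spectrum B lambda -> complex.Re lambda <= spectral_abscissa B.
Proof.
move=> N0; rewrite /spectral_abscissa.
have [r [sr ->]] := spectrumE B.
have [|m /mapP[l lr ml] mP] := @seq_max_ex R [seq complex.Re z | z <- r].
  by rewrite size_map sr.
have mub x : (exists2 z, z \in r & complex.Re z = x) -> x <= m.
  by case=> z zr <-; apply: mP; exact: map_f.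
have -> : sup [set complex.Re z | z in [set z | z \in r]] = m.
  apply/eqP; rewrite eq_le; apply/andP; split.
    apply: ge_sup; last by move=> x; exact: mub.
    by exists m, l.
  by apply: ub_le_sup; [exists m => x; exact: mub | exists l].
by split; [exists l | move=> z zr; apply: mub; exists z].
Qed.

Definition expm (R : realType) (N : nat) (A : 'M[R]_N) : 'M[R]_N :=
  limn (series (fun k : nat => k`!%:R^-1 *: A ^+ k)).

Definition mx_integrable (R : realType) (N : nat) (D : set R)
    (F : R -> 'M[R]_N) : Prop :=
  forall i j : 'I_N,
    (@lebesgue_measure R).-integrable D (fun s => (F s i j)%:E).

Definition mx_integral (R : realType) (N : nat) (D : set R)
    (F : R -> 'M[R]_N) : 'M[R]_N :=
  \matrix_(i, j) (\int[@lebesgue_measure R]_(s in D) F s i j).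

Definition psdmx (R : realType) (N : nat) (A : 'M[R]_N) : Prop :=
  A^T = A /\ forall x : 'cV[R]_N, 0 <= (x^T *m A *m x) 0 0.

Definition loewner_le (R : realType) (N : nat) (A B : 'M[R]_N) : Prop :=
  psdmx (B - A).

Definition gram_integrand (R : realType) (N : nat) (Q B : 'M[R]_N) (s : R) :
  'M[R]_N := expm (s *: B) *m Q *m expm (s *: B^T).

Definition Kmx (R : realType) (N : nat) (Q B : 'M[R]_N) (t : R) : 'M[R]_N :=
  t^-1 *: mx_integral `[0, t] (gram_integrand Q B).

Definition Kmx_infty (R : realType) (N : nat) (Q B : 'M[R]_N) : 'M[R]_N :=
  mx_integral `[0, +oo[ (gram_integrand Q B).

(* The N-dimensional Lebesgue measure, on N-tuples of reals, as an iterated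
   product of one-dimensional ones. *)
Definition cons_pair (T : Type) (n : nat) (p : T * n.-tuple T) :
  n.+1.-tuple T := [tuple of p.1 :: p.2].

Fixpoint lebesgue_tuple (R : realType) (n : nat) :
    set (n.-tuple (measurableTypeR R)) -> \bar R :=
  match n with
  | 0 => \d_[tuple]
  | m.+1 => pushforward
      (@lebesgue_measure R \x @lebesgue_tuple R m)%E
      (@cons_pair (measurableTypeR R) m)
  end.

Lemma thead_cons_pair (T : Type) (n : nat) (p : T * n.-tuple T) :
  thead (cons_pair p) = p.1.
Proof. exact: theadE. Qed.

Lemma behead_cons_pair (T : Type) (n : nat) (p : T * n.-tuple T) :
  [tuple of behead (cons_pair p)] = p.2.
Proof. exact/val_inj. Qed.

Lemma tnth_cons_pair (T : Type) (n : nat) (p : T * n.-tuple T) (i : 'I_n) :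
  tnth (cons_pair p) (lift ord0 i) = tnth p.2 i.
Proof. by rewrite tnthS; congr tnth; exact/val_inj. Qed.

Lemma measurable_cons_pair (R : realType) (n : nat) :
  measurable_fun setT (@cons_pair (measurableTypeR R) n).
Proof.
by apply: measurable_cons; [exact: measurable_fst|exact: measurable_snd].
Qed.

Lemma product_measure_sigma_finite (d1 d2 : measure_display)
    (T1 : measurableType d1) (T2 : measurableType d2) (R : realType)
    (m1 : {sigma_finite_measure set T1 -> \bar R})
    (m2 : {sigma_finite_measure set T2 -> \bar R}) :
  sigma_finite setT (m1 \x m2)%E.
Proof.
have /sigma_finiteP[F [TF ndF Foo]] := sigma_finiteT m1.
have /sigma_finiteP[G [TG ndG Goo]] := sigma_finiteT m2.
exists (fun n => F n `*` G n).
 rewrite -setXTT TF TG predeqE => -[x y]; split.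
    move=> [/= [n _ Fnx] [k _ Gky]]; exists (maxn n k) => //; split.
    - by move: x Fnx; exact/subsetPset/ndF/leq_maxl.
    - by move: y Gky; exact/subsetPset/ndG/leq_maxr.
  by move=> [n _ []/= ? ?]; split; exists n.
move=> k; have [? ?] := Foo k; have [? ?] := Goo k.
split; first exact: measurableX.
by rewrite product_measure1E// lte_mul_pinfty// ge0_fin_numE.
Qed.

Lemma pushforward_sigma_finite (d1 d2 : measure_display)
    (T1 : measurableType d1) (T2 : measurableType d2) (R : realType)
    (nu : {measure set T1 -> \bar R}) (f : T1 -> T2) (g : T2 -> T1) :
  sigma_finite setT nu -> measurable_fun setT f -> measurable_fun setT g -> cancel f g ->
  exists mu : {sigma_finite_measure set T2 -> \bar R},
    pushforward nu f = mu :> (set T2 -> \bar R).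
Proof.
move=> [F TF FP] mf mg fK; pose m1 : set T2 -> \bar R := pushforward nu f.
have m10 : m1 set0 = 0%E by rewrite /m1 /pushforward preimage_set0 measure0.
have m1_ge0 A : (0 <= m1 A)%E by exact: measure_ge0.
have m1s : semi_sigma_additive m1.
  move=> G mG tG mUG; rewrite /m1 /pushforward preimage_bigcup.
  apply: measure_semi_sigma_additive.
  - by move=> k; rewrite -[X in measurable X]setTI; exact: mf.
  - apply/trivIsetP => /= i j _ _ ij; rewrite -preimage_setI.
    by move/trivIsetP : tG => /(_ _ _ _ _ ij) ->//; rewrite preimage_set0.
  - by rewrite -preimage_bigcup -[X in measurable X]setTI; exact: mf.
pose H1 := isMeasure.Build _ _ _ m1 m10 m1_ge0 m1s.
pose mm : {measure set T2 -> \bar R} := HB.pack_for (Measure.type T2 R) m1 H1.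
have m1fin : sigma_finite setT mm.
  exists (fun k => g @^-1` F k); first by rewrite -preimage_bigcup -TF.
  move=> k; have [mFk Fk] := FP k; split.
    by rewrite -[X in measurable X]setTI; exact: mg.
  rewrite /mm /= /m1 /pushforward -comp_preimage.
  by rewrite (_ : g \o f = id) ?preimage_id//; apply/funext.
pose H2 := isSFinite.Build _ _ _ _ (sfinite_measure_sigma_finite m1fin).
pose H3 := isSigmaFinite.Build _ _ _ _ m1fin.
by exists (HB.pack_for (SigmaFiniteMeasure.type T2 R) (Measure.sort mm) H2 H3).
Qed.

Lemma lebesgue_tuple_measure (R : realType) (n : nat) :
  exists mu : {sigma_finite_measure set (n.-tuple (measurableTypeR R)) -> \bar R},
    lebesgue_tuple (n := n) = mu :> (set _ -> \bar R).
Proof.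
elim: n => [|n [mu muE]]; first by exists \d_[tuple].
rewrite /= muE; pose T := measurableTypeR R.
apply: (@pushforward_sigma_finite _ _ _ _ _ _ _
  (fun t : n.+1.-tuple T => (thead t, [tuple of behead t]))).
- exact: product_measure_sigma_finite.
- exact: measurable_cons_pair.
- apply/measurable_fun_pairP; split; last exact: measurable_behead.
  exact: measurable_tnth.
- by move=> [x y]; rewrite thead_cons_pair behead_cons_pair.
Qed.

Lemma lebesgue_tuple_box (R : realType) (n : nat)
    (I : 'I_n -> set (measurableTypeR R)) : (forall i, measurable (I i)) ->
  lebesgue_tuple [set v : n.-tuple (measurableTypeR R) |
    forall i, I i (tnth v i)] = (\prod_(i < n) @lebesgue_measure R (I i))%E.
Proof.
elim: n I => [|n IH] I mI.
  by rewrite big_ord0 /= diracE mem_set// => -[].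
rewrite big_ord_recl /= -IH//=.
have [mu ->] := lebesgue_tuple_measure R n.
rewrite -product_measure1E//; last first.
  rewrite [X in measurable X](_ : _ = \bigcap_(i : 'I_n) ((@tnth n _)^~ i @^-1` (I (lift ord0 i)))).
    apply: fin_bigcap_measurable => // i _.
    by rewrite -[X in measurable X]setTI; exact: measurable_tnth.
  by apply/seteqP; split => v /= h i; [move=> _; exact: h | exact: h].
rewrite /pushforward; congr (_ _); apply/seteqP; split => -[x y] /=.
  move=> h; split; first exact: (h ord0).
  by move=> i; have := h (lift ord0 i); rewrite tnth_cons_pair.
move=> [h0 h] i; case: (unliftP ord0 i) => [j ->|->//].
by rewrite tnth_cons_pair.
Qed.

Definition unit_ball (R : realType) (N : nat) :
    set (N.-tuple (measurableTypeR R)) :=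
  [set v | \sum_(i < N) (tnth v i : R) ^+ 2 < 1].

Definition omega (R : realType) (N : nat) : R :=
  fine (lebesgue_tuple (@unit_ball R N)).

Definition volume (R : realType) (N : nat) (Q B : 'M[R]_N) (t : R) : R :=
  omega R N * Num.sqrt (\det (t *: Kmx Q B t)).

(* Main.v *)
Require Import Defs.
From mathcomp Require Import all_boot all_order all_algebra.
From mathcomp Require Import all_classical all_reals all_analysis.
From mathcomp Require Import complex measurable_realfun ring lra.
Set Implicit Arguments.
Unset Strict Implicit.
Unset Printing Implicit Defensive.
Import Order.TTheory GRing.Theory Num.Theory.
Import numFieldTopology.Exports numFieldNormedType.Exports.
Local Open Scope classical_set_scope.
Local Open Scope ring_scope.

(* Write C(t) = t K(t) and E(s) = e^{sB}.

   Abscissa >= 0: let x + i y be a left eigenvector of B for an eigenvalue with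
   real part a >= 0, and let f(s) be the sum of the quadratic forms of
   E(s) Q E(s)^T at x and y. Then f' = 2 a f >= 0, so the sum of the quadratic
   forms of C(t) at x and y, which is the integral of f over [0, t], is at least
   t times its value at t = 1. Since C(t) >= C(1) > 0, its determinant dominates
   a constant multiple of each of these forms: taking the vector as first basis
   vector, det M is M_00 times the determinant of the Schur complement, and
   Schur complements and determinants are monotone in the Loewner order.

   Abscissa < 0: the product of the factors B - l over the roots l of the
   characteristic polynomial vanishes. Removing the factors one at a time, the
   real and imaginary parts of the entries of E(s) Z solve
   p' = a p - b q + h1, q' = b p + a q + h2 with a < 0 and h square integrable
   on [0, oo), hence are square integrable themselves. The entries of the
   integrand are thus dominated by an integrable function. *)

(** * Determinants of positive definite matrices *)

Definition qform (F : pzRingType) n (M : 'M[F]_n) (x : 'cV[F]_n) : F :=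
  (x^T *m M *m x) 0 0.

Definition posdefmx (F : realFieldType) n (M : 'M[F]_n) : Prop :=
  M^T = M /\ forall x, x != 0 -> 0 < qform M x.

Definition schur (F : fieldType) n (M : 'M[F]_(1 + n)) : 'M[F]_n :=
  drsubmx M - (M 0 0)^-1 *: (dlsubmx M *m ursubmx M).

Lemma ulsubmx11 (F : pzRingType) n (M : 'M[F]_(1 + n)) :
  ulsubmx M = (M 0 0)%:M.
Proof. by rewrite [ulsubmx M]mx11_scalar !mxE !lshift0. Qed.

(** One step of Gaussian elimination: the unipotent left factor clears the first column below the
    corner entry. *)
Lemma schur_factor (F : fieldType) n (M : 'M[F]_(1 + n)) : M 0 0 != 0 ->
  M = block_mx 1%:M 0 ((M 0 0)^-1 *: dlsubmx M) 1%:M *m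
      block_mx (ulsubmx M) (ursubmx M) 0 (schur M).
Proof.
move=> M00; rewrite mulmx_block !mul1mx !mul0mx !addr0 -!scalemxAl.
rewrite [X in _ *: (_ *m X)]ulsubmx11 mul_mx_scalar scalerA mulVf// scale1r.
by rewrite /schur addrC subrK submxK.
Qed.

Lemma det_schur (F : fieldType) n (M : 'M[F]_(1 + n)) : M 0 0 != 0 ->
  \det M = M 0 0 * \det (schur M).
Proof.
move=> M00; rewrite {1}(schur_factor M00) det_mulmx det_lblock det_ublock.
by rewrite !det1 !mul1r ulsubmx11 det_scalar1.
Qed.

(** Completing the square in the first coordinate [z]; symmetry of [M] makes the two cross terms
    equal. *)
Lemma qform_schur (F : fieldType) n (M : 'M[F]_(1 + n)) z y :
  M^T = M -> M 0 0 != 0 ->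
  qform M (col_mx z%:M y) =
    M 0 0 * (z + (ursubmx M *m y) 0 0 / M 0 0) ^+ 2 + qform (schur M) y.
Proof.
move=> MT M00; set u := (ursubmx M *m y) 0 0.
have uE : ursubmx M *m y = u%:M by rewrite [LHS]mx11_scalar.
have uTE : y^T *m dlsubmx M = u%:M.
  by rewrite -[LHS]trmxK trmx_mul trmxK trmx_dlsub MT uE tr_scalar_mx.
have -> : qform (schur M) y = qform (drsubmx M) y - (M 0 0)^-1 * u ^+ 2.
  rewrite /qform /schur mulmxBr mulmxBl -scalemxAr -scalemxAl !mulmxA uTE.
  by rewrite -(mulmxA u%:M) uE -scalar_mxM !mxE mulr1n expr2.
have -> : qform M (col_mx z%:M y) =
    M 0 0 * z ^+ 2 + u * z + z * u + qform (drsubmx M) y.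
  rewrite /qform -{1}(submxK M) tr_col_mx tr_scalar_mx mul_row_block.
  rewrite mul_row_col !mulmxDl ulsubmx11 uTE -(mulmxA _ (ursubmx M)) uE.
  rewrite -!scalar_mxM !mxE !mulr1n; ring.
by field.
Qed.

Lemma posdefmx_ge0 (F : realFieldType) n (M : 'M[F]_n) x :
  posdefmx M -> 0 <= qform M x.
Proof.
move=> [_ M0]; have [->|/M0/ltW//] := eqVneq x 0.
by rewrite /qform mulmx0 mxE.
Qed.

Lemma posdefmx_gt00 (F : realFieldType) n (M : 'M[F]_n.+1) :
  posdefmx M -> 0 < M 0 0.
Proof.
move=> [_ M0]; have := M0 (delta_mx 0 0).
have -> : qform M (delta_mx 0 0) = M 0 0.
  by rewrite /qform trmx_delta -rowE -colE !mxE.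
apply; apply/eqP => /matrixP/(_ 0 0); rewrite !mxE !eqxx => /eqP.
by rewrite oner_eq0.
Qed.

(** The choice of [z] that kills the square in [qform_schur] turns the form of the Schur complement
    at [y] into a value of the form of [M]. *)
Lemma posdefmx_schur (F : realFieldType) n (M : 'M[F]_(1 + n)) :
  posdefmx M -> posdefmx (schur M).
Proof.
move=> Mpd; have M00 := posdefmx_gt00 Mpd; have [MT M0] := Mpd; split.
  rewrite /schur linearB/= linearZ/= trmx_mul.
  by rewrite trmx_dlsub trmx_drsub trmx_ursub MT.
move=> y y0; set z := - ((ursubmx M *m y) 0 0 / M 0 0).
have := qform_schur z y MT (lt0r_neq0 M00).
rewrite addNr expr0n mulr0 add0r => <-; apply: M0.
apply: contraNneq y0 => /(congr1 dsubmx).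
by rewrite col_mxKd linear0 => ->.
Qed.

(** By [qform_schur], the form of the Schur complement at [y] is the minimum over [z] of the form of
    the whole matrix. Both forms are evaluated at the minimiser [z] for [M], where that of [M1] can
    only exceed its own minimum. *)
Lemma schur_mono (F : realFieldType) n (M1 M : 'M[F]_(1 + n)) :
  posdefmx M1 -> posdefmx M -> (forall x, qform M1 x <= qform M x) ->
  forall y, qform (schur M1) y <= qform (schur M) y.
Proof.
move=> M1pd Mpd M1M y; have M100 := posdefmx_gt00 M1pd.
have M00 := posdefmx_gt00 Mpd.
set z := - ((ursubmx M *m y) 0 0 / M 0 0).
have := M1M (col_mx z%:M y).
rewrite (qform_schur z y (proj1 Mpd))// ?lt0r_neq0//.
rewrite addNr expr0n mulr0 add0r; apply: le_trans.
rewrite (qform_schur z y (proj1 M1pd))// ?lt0r_neq0// lerDr.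
by rewrite mulr_ge0 ?sqr_ge0// ltW.
Qed.

(** Induction on the size: both factors in [det_schur] are monotone, the corner entry being the
    value of the form at the first basis vector. *)
Lemma det_posdefmx_mono (F : realFieldType) n (M1 M : 'M[F]_n) :
  posdefmx M1 -> posdefmx M -> (forall x, qform M1 x <= qform M x) ->
  0 < \det M1 <= \det M.
Proof.
elim: n => [|n IH] in M1 M *.
  by move=> *; rewrite !det_mx00 ltr01 lexx.
rewrite -[n.+1]/(1 + n)%N in M1 M * => M1pd Mpd M1M.
have M100 := posdefmx_gt00 M1pd; have M00 := posdefmx_gt00 Mpd.
have /andP[S0 SS] := IH _ _ (posdefmx_schur M1pd) (posdefmx_schur Mpd)
  (schur_mono M1pd Mpd M1M).
rewrite !det_schur ?lt0r_neq0// mulr_gt0//=.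
apply: ler_pM => //; try exact: ltW.
have := M1M (delta_mx 0 0).
by rewrite /qform trmx_delta -!rowE -!colE !mxE.
Qed.

(** After [det_schur] both sides carry the factor [M 0 0 * M1 0 0], and only the determinants of the
    Schur complements are left to compare. *)
Lemma det_posdefmx_ratio (F : realFieldType) n (M1 M : 'M[F]_n.+1) :
  posdefmx M1 -> posdefmx M -> (forall x, qform M1 x <= qform M x) ->
  M 0 0 * \det M1 <= M1 0 0 * \det M.
Proof.
rewrite -[n.+1]/(1 + n)%N in M1 M * => M1pd Mpd M1M.
have M100 := posdefmx_gt00 M1pd; have M00 := posdefmx_gt00 Mpd.
have /andP[_ SS] := det_posdefmx_mono (posdefmx_schur M1pd) (posdefmx_schur Mpd)
  (schur_mono M1pd Mpd M1M).
rewrite !det_schur ?lt0r_neq0// mulrCA.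
by apply: ler_wpM2l; [exact: ltW|apply: ler_wpM2l; [exact: ltW|]].
Qed.

Lemma qform_congr (F : comPzRingType) n (P M : 'M[F]_n) x :
  qform (P^T *m M *m P) x = qform M (P *m x).
Proof. by rewrite /qform trmx_mul !mulmxA. Qed.

Lemma posdefmx_congr (F : realFieldType) n (P M : 'M[F]_n) :
  P \in unitmx -> posdefmx M -> posdefmx (P^T *m M *m P).
Proof.
move=> Pu [MT M0]; split; first by rewrite !trmx_mul trmxK MT mulmxA.
move=> x x0; rewrite qform_congr; apply: M0.
by apply: contraNneq x0 => /(congr1 (mulmx (invmx P))); rewrite mulKmx// mulmx0 => ->.
Qed.

Lemma unitmx_first_col (F : fieldType) n (x : 'cV[F]_n.+1) : x != 0 ->
  exists2 P : 'M[F]_n.+1, P \in unitmx & P *m delta_mx 0 0 = x.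
Proof.
(* Every row of [f] is [x^T], so [f] sends the first basis row vector to [x^T] without loss of rank;
   [complete_unitmx] replaces it by an invertible matrix with the same image of that vector.
   Transposing passes to columns. *)
move=> x0; pose f : 'M[F]_n.+1 := \matrix_(i, j) x j 0.
have fE : (delta_mx 0 0 : 'rV_n.+1) *m f = x^T.
  by apply/rowP => i; rewrite -rowE !mxE.
have [|g gu gE] := @complete_unitmx _ _ _ (delta_mx 0 0 : 'rV[F]_n.+1) f.
  rewrite fE mxrank_delta rank_rV; case: eqVneq => // xT0.
  by rewrite -[x]trmxK xT0 trmx0 eqxx in x0.
exists g^T; first by rewrite unitmx_tr.
by rewrite -[delta_mx 0 0]trmxK trmx_delta -trmx_mul -gE fE trmxK.
Qed.

(* In a basis whose first vector is [x] this is [det_posdefmx_ratio]. *)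
Lemma det_ge_qform (F : realFieldType) n (M1 : 'M[F]_n.+1) x : posdefmx M1 ->
  exists2 c, 0 < c & forall M, posdefmx M ->
    (forall y, qform M1 y <= qform M y) -> c * qform M x <= \det M.
Proof.
move=> M1pd; have [->|x0] := eqVneq x 0.
  exists 1 => // M Mpd M1M; rewrite /qform mulmx0 mxE mulr0.
  by have /andP[/ltW] := det_posdefmx_mono M1pd Mpd M1M; exact: le_trans.
have [P Pu Px] := unitmx_first_col x0.
have qE M : (P^T *m M *m P) 0 0 = qform M x.
  rewrite -Px -qform_congr /qform trmx_delta -rowE -colE !mxE.
  by apply: eq_bigr.
have dM1 : 0 < \det M1.
  by have /andP[] := det_posdefmx_mono M1pd M1pd (fun=> lexx _).
have q1 : 0 < qform M1 x by apply: (proj2 M1pd).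
(* This is [det_posdefmx_ratio] for the congruent matrices, rearranged; the congruence multiplies
   both determinants by [\det P ^+ 2], which cancels. *)
exists (\det M1 / qform M1 x); first by rewrite divr_gt0.
move=> M Mpd M1M.
have := det_posdefmx_ratio (posdefmx_congr Pu M1pd) (posdefmx_congr Pu Mpd).
rewrite !qE !det_mulmx det_tr => H.
have {}H := H (fun y => _); rewrite mulrAC ler_pdivrMr//.
have dP : 0 < \det P ^+ 2.
  by rewrite exprn_even_gt0//= -unitfE -unitmxE.
rewrite -(ler_pM2l dP) expr2.
have: qform M x * (\det P * \det M1 * \det P) <= qform M1 x * (\det P * \det M * \det P).
  by apply: H => y; rewrite !qform_congr.
by lra.
Qed.

(** A zero [x] of a nonnegative form is a minimiser, so the gradient [M *m x] vanishes there:
    otherwise a small step from [x] along [- M *m x] would make the form negative. Invertibility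
    then gives [x = 0]. *)
Lemma psd_unit_posdef (F : realFieldType) n (M : 'M[F]_n) :
  M^T = M -> (forall x, 0 <= qform M x) -> M \in unitmx -> posdefmx M.
Proof.
move=> MT M0 Mu; split=> // x x0; rewrite lt_def M0 andbT.
apply: contraNneq x0 => qx0.
pose y := M *m x.
have yy : (y^T *m y) 0 0 = \sum_i y i 0 ^+ 2.
  by rewrite mxE; apply: eq_bigr => i _; rewrite mxE expr2.
have qE e : qform M (x - e *: y) = - (2 * e) * (y^T *m y) 0 0 + e ^+ 2 * qform M y.
  have xy : x^T *m M = y^T by rewrite trmx_mul MT.
  have yMx : y^T *m M *m x = y^T *m y by rewrite -mulmxA.
  have tE : (x - e *: y)^T = x^T - e *: y^T by rewrite [LHS]linearB/= linearZ.
  rewrite /qform tE !mulmxBl -!scalemxAl !mulmxBr -!scalemxAr yMx xy.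
  move: qx0; rewrite /qform xy => qx0.
  rewrite !mxE in qx0 *; rewrite qx0; ring.
suff y0 : y = 0 by rewrite -(mulKmx Mu x) -/y y0 mulmx0.
have ss0 : (y^T *m y) 0 0 = 0.
  pose s : F := (y^T *m y) 0 0; rewrite -/s in yy qE *.
  have s0 : 0 <= s by rewrite yy sumr_ge0// => i _; exact: sqr_ge0.
  apply/eqP; rewrite eq_le s0 andbT leNgt; apply/negP => sp.
  have qy := M0 y; set q := qform M y in qE qy.
  (* The step length [s / q] would minimise the quadratic in [e]; adding 1 to the denominator covers
     [q = 0] and still yields a negative value. *)
  have := M0 (x - (s / (q + 1)) *: y); rewrite qE.
  have q1 : 0 < q + 1 by lra.
  have -> : - (2 * (s / (q + 1))) * s + (s / (q + 1)) ^+ 2 * q =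
     - (s / (q + 1)) ^+ 2 * (q + 2) by field; exact: lt0r_neq0.
  have : 0 < (s / (q + 1)) ^+ 2 by rewrite exprn_gt0// divr_gt0.
  nra.
apply/colP => i; rewrite [RHS]mxE; apply/eqP; rewrite -sqrf_eq0; apply/eqP.
move: ss0; rewrite yy => /psumr_eq0P; apply => // j _; exact: sqr_ge0.
Qed.

(** * The matrix exponential *)

Lemma cvg_mx (R : realType) (T : Type) (F : set_system T) m n
    (f : T -> 'M[R]_(m, n)) (L : 'M[R]_(m, n)) : Filter F ->
  (forall i j, f x i j @[x --> F] --> L i j) -> f @ F --> L.
Proof.
move=> FF fL; apply/cvg_ballP => e e0.
have : \forall x \near F, forall ij, ball (L ij.1 ij.2) e (f x ij.1 ij.2).
  by apply: filter_forall => -[i j] /=; exact: (cvg_ball (fL i j)).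
by apply: filterS => x h; split=> // i j; exact: (h (i, j)).
Qed.

Lemma mx_hausdorff (R : realType) n : hausdorff_space 'M[R]_n.
Proof. exact: norm_hausdorff. Qed.

Lemma pseries_le_cvg (R : realType) (a : R^nat) (C b x : R) :
  (forall k, `|a k| <= C * (b ^+ k / k`!%:R)) -> cvgn (pseries a x).
Proof.
move=> aC; apply: normed_cvg.
have ukv k : `|a k * x ^+ k| <= C * exp_coeff (b * `|x|) k.
  rewrite normrM normrX /exp_coeff /= exprMn.
  by have := ler_wpM2r (exprn_ge0 k (normr_ge0 x)) (aC k); lra.
apply: (@series_le_cvg _ _ (fun k => C * exp_coeff (b * `|x|) k)).
- by move=> k; exact: normr_ge0.
- move=> k; apply: le_trans (ukv k); exact: normr_ge0.
- exact: ukv.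
- apply: is_cvg_seriesZ; exact: is_cvg_series_exp_coeff.
Qed.

Lemma expmxZ (R : comPzRingType) n (B : 'M[R]_n) (s : R) k :
  (s *: B) ^+ k = s ^+ k *: B ^+ k.
Proof.
elim: k => [|k IH]; first by rewrite !expr0 scale1r.
rewrite !exprS IH.
exact: (etrans (esym (scalemxAl _ _ _))
  (etrans (congr1 _ (esym (scalemxAr _ _ _))) (scalerA _ _ _))).
Qed.

Lemma trmx_expmx (R : comPzRingType) n (B : 'M[R]_n) k : (B ^+ k)^T = B^T ^+ k.
Proof.
elim: k => [|k IH]; first by rewrite !expr0 trmx1.
by rewrite exprS exprSr -IH; exact: trmx_mul.
Qed.

(** The sum of the absolute values of all entries bounds every row sum of absolute values, which is
    what the induction on [k] uses. *)
Lemma mx_exp_bound (R : realType) n (B : 'M[R]_n) k i j :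
  `|(B ^+ k) i j| <= (\sum_i \sum_j `|B i j|) ^+ k.
Proof.
set b := \sum_i _.
have b0 : 0 <= b by apply: sumr_ge0 => l _; apply: sumr_ge0.
elim: k i j => [|k IH] i j.
  by rewrite !expr0 mxE; case: (i == j); rewrite ?normr1 ?normr0.
rewrite exprS mxE; apply: le_trans (ler_norm_sum _ _ _) _.
have bi : \sum_l `|B i l| <= b.
  by rewrite /b [leRHS](bigD1 i)//= lerDl; apply: sumr_ge0 => l _; exact: sumr_ge0.
rewrite exprS; apply: le_trans (ler_wpM2r (exprn_ge0 k b0) bi).
by rewrite mulr_suml; apply: ler_sum => l _; rewrite normrM ler_wpM2l.
Qed.

(** Coefficient of [s ^+ k] in an entry of [expm (s *: B)]: each entry is treated as a scalar power
    series, so that termwise differentiation applies. *)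
Definition expm_coef (R : realType) n (B : 'M[R]_n) i j (k : nat) : R :=
  k`!%:R^-1 * (B ^+ k) i j.

Lemma is_cvg_expm_coef (R : realType) n (B : 'M[R]_n) i j x :
  cvgn (pseries (expm_coef B i j) x).
Proof.
apply: (@pseries_le_cvg _ _ 1 (\sum_i \sum_j `|B i j|)) => k.
rewrite mul1r normrM [`|_^-1|]ger0_norm ?invr_ge0// mulrC.
by apply: ler_wpM2r; rewrite ?invr_ge0// mx_exp_bound.
Qed.

Lemma expmE (R : realType) n (B : 'M[R]_n) s i j :
  expm (s *: B) i j = limn (pseries (expm_coef B i j) s).
Proof.
suff -> : expm (s *: B) = \matrix_(i, j) limn (pseries (expm_coef B i j) s).
  by rewrite mxE.
apply: cvg_lim; first exact: mx_hausdorff.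
apply: cvg_mx => k l; rewrite mxE.
apply: cvg_trans (@is_cvg_expm_coef _ _ B k l s).
apply: near_eq_cvg; apply: nearW => m /=.
rewrite /pseries /series /= summxE; apply: eq_bigr => p _.
by rewrite expmxZ scalerA !mxE /expm_coef mulrAC.
Qed.

(** Since [B ^+ k.+1 = B * B ^+ k], the differentiated series is that of the same entry of
    [B *m expm (s *: B)]. *)
Lemma pseries_diffs_expm_coef (R : realType) n (B : 'M[R]_n) i j :
  pseries_diffs (expm_coef B i j) =
  fun k => \sum_l B i l * expm_coef B l j k.
Proof.
apply/funext => k; rewrite /pseries_diffs /expm_coef exprS mxE.
rewrite factS natrM invfM mulrA mulVKf// mulr_sumr; apply: eq_bigr => l _.
by rewrite mulrCA.
Qed.

Lemma is_cvg_expm_coef_sum (R : realType) n (B : 'M[R]_n) (a : 'I_n -> R) j x :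
  pseries (fun k => \sum_l a l * expm_coef B l j k) x @ \oo -->
  \sum_l a l * limn (pseries (expm_coef B l j) x).
Proof.
have -> : pseries (fun k => \sum_l a l * expm_coef B l j k) x =
    fun m => \sum_l a l * pseries (expm_coef B l j) x m.
  apply/funext => m; rewrite /pseries /series /=.
  under eq_bigr do rewrite mulr_suml.
  rewrite exchange_big/=; apply: eq_bigr => l _; rewrite mulr_sumr.
  by apply: eq_bigr => p _; rewrite mulrA.
apply: cvg_big; first exact: add_continuous.
by move=> l _; apply: cvgMl_tmp; exact: is_cvg_expm_coef.
Qed.

Lemma is_derive_expm (R : realType) n (B : 'M[R]_n) i j (s : R) :
  is_derive s 1 (fun s => expm (s *: B) i j) ((B *m expm (s *: B)) i j).
Proof.
have dd x : cvgn (pseries (pseries_diffs (expm_coef B i j)) x).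
  rewrite pseries_diffs_expm_coef; apply/cvg_ex; eexists.
  exact: is_cvg_expm_coef_sum.
(* Termwise differentiation by [pseries_snd_diffs] also asks for convergence of the twice
   differentiated series, which is that of an entry of [B *m B *m expm (s *: B)]. *)
have ddd x : cvgn (pseries (pseries_diffs (pseries_diffs (expm_coef B i j))) x).
  have -> : pseries_diffs (pseries_diffs (expm_coef B i j)) =
      fun k => \sum_l (\sum_p B i p * B p l) * expm_coef B l j k.
    apply/funext => k; rewrite pseries_diffs_expm_coef {1}/pseries_diffs mulr_sumr.
    under [RHS]eq_bigr do rewrite mulr_suml.
    rewrite exchange_big/=; apply: eq_bigr => l _.
    have := congr1 (@^~ k) (pseries_diffs_expm_coef B l j).
    rewrite {1}/pseries_diffs /= => h; rewrite mulrCA h.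
    by rewrite mulr_sumr; apply: eq_bigr => p _; rewrite mulrA.
  by apply/cvg_ex; eexists; exact: is_cvg_expm_coef_sum.
have xs : `|s| < `|(`|s| + 1)|.
  by rewrite [ltRHS]ger0_norm ?addr_ge0// ltrDl.
have := pseries_snd_diffs (@is_cvg_expm_coef _ _ B i j _) (dd _) (ddd _) xs.
have -> : (fun s => expm (s *: B) i j) = (fun x => limn (pseries (expm_coef B i j) x)).
  by apply/funext => x; rewrite expmE.
suff -> : (B *m expm (s *: B)) i j = limn (pseries (pseries_diffs (expm_coef B i j)) s) by [].
rewrite mxE pseries_diffs_expm_coef; apply/esym/cvg_lim => //.
under eq_bigr do rewrite expmE.
exact: is_cvg_expm_coef_sum.
Qed.

Lemma expm_tr (R : realType) n (B : 'M[R]_n) s :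
  expm (s *: B^T) = (expm (s *: B))^T.
Proof.
apply/matrixP => i j; rewrite mxE !expmE; congr (limn (pseries _ _)).
apply/funext => k; rewrite /expm_coef; congr (_ * _).
by rewrite -[in LHS]trmx_expmx mxE.
Qed.

(** * Integrals of continuous functions over [0, t] *)

Lemma is_derive1_continuous (R : realType) (f f' : R -> R) :
  (forall s : R, is_derive s 1 f (f' s)) -> continuous f.
Proof.
move=> df s; apply: differentiable_continuous; apply/derivable1_diffP.
by have [] := df s.
Qed.

Definition int0 (R : realType) (f : R -> R) (t : R) : R :=
  \int[@lebesgue_measure R]_(s in `[0, t]) f s.

Lemma continuous_integrable_itv (R : realType) (f : R -> R) a b : continuous f ->
  (@lebesgue_measure R).-integrable `[a, b] (EFin \o f).
Proof.
move=> cf; apply: continuous_compact_integrable; first exact: segment_compact.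
exact: continuous_subspaceT.
Qed.

Lemma int0D (R : realType) (f g : R -> R) t : continuous f -> continuous g ->
  int0 (fun s => f s + g s) t = int0 f t + int0 g t.
Proof. by move=> cf cg; rewrite /int0 RintegralD//; exact: continuous_integrable_itv. Qed.

Lemma int0B (R : realType) (f g : R -> R) t : continuous f -> continuous g ->
  int0 (fun s => f s - g s) t = int0 f t - int0 g t.
Proof. by move=> cf cg; rewrite /int0 RintegralB//; exact: continuous_integrable_itv. Qed.

Lemma int0Z (R : realType) c (f : R -> R) t : continuous f ->
  int0 (fun s => c * f s) t = c * int0 f t.
Proof. by move=> cf; rewrite /int0 RintegralZl//; exact: continuous_integrable_itv. Qed.

Lemma le_int0 (R : realType) (f g : R -> R) t : continuous f -> continuous g ->
  (forall s, 0 <= s -> f s <= g s) -> int0 f t <= int0 g t.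
Proof.
move=> cf cg fg; apply: le_Rintegral => //; try exact: continuous_integrable_itv.
by move=> s /=; rewrite in_itv/= => /andP[/fg].
Qed.

Lemma continuousT_sum (R : realType) (I : Type) (r : seq I) (f : I -> R -> R) :
  (forall i, continuous (f i)) -> continuous (fun s => \sum_(i <- r) f i s).
Proof. move=> cf; apply: continuous_big => //; exact: add_continuous. Qed.

Lemma int0_sum (R : realType) (I : Type) (r : seq I) (f : I -> R -> R) t :
  (forall i, continuous (f i)) ->
  int0 (fun s => \sum_(i <- r) f i s) t = \sum_(i <- r) int0 (f i) t.
Proof.
move=> cf; elim: r => [|i r IH].
  rewrite big_nil /int0; under eq_Rintegral do rewrite big_nil.
  by rewrite Rintegral_cst// mul0r.
rewrite big_cons -IH -int0D//; last exact: continuousT_sum.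
by apply: eq_Rintegral => s _; rewrite big_cons.
Qed.

Lemma int0_mono_from (R : realType) (f : R -> R) s t : continuous f ->
  0 <= s -> (forall x, s <= x -> 0 <= f x) -> s <= t -> int0 f s <= int0 f t.
Proof.
move=> cf s0 f0 st; rewrite -subr_ge0 /int0 Rintegral_itvB ?bnd_simp//.
  by apply: Rintegral_ge0 => x /=; rewrite in_itv/= => /andP[/ltW/f0].
exact: continuous_integrable_itv.
Qed.

(** For [s < 0] the interval from 0 to [s] is empty and [int0 f s] is 0. Hence [int0 f] is
    nondecreasing on the whole line, the form required by [nondecreasing_cvgr]. *)
Lemma int0_mono (R : realType) (f : R -> R) s t : continuous f ->
  (forall x, 0 <= x -> 0 <= f x) -> s <= t -> int0 f s <= int0 f t.
Proof.
move=> cf f0 st; have [s0|s0] := leP 0 s.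
  by apply: int0_mono_from => // x /(le_trans s0)/f0.
rewrite {1}/int0 set_itv_ge ?bnd_simp -?ltNge// Rintegral_set0.
by apply: Rintegral_ge0 => x /=; rewrite in_itv/= => /andP[/f0].
Qed.

Lemma int0_cst (R : realType) (c t : R) : 0 <= t -> int0 (fun=> c) t = c * t.
Proof.
move=> t0; rewrite /int0 Rintegral_cst// /= lebesgue_measure_itv/= lte_fin.
by move: t0; rewrite le_eqVlt => /predU1P[<-|->]; rewrite ?ltxx// sube0.
Qed.

(* By monotonicity [f 1] dominates the mean of [f] over [[0, 1]]. *)
Lemma int0_nondecreasing_ge (R : realType) (f : R -> R) t : continuous f ->
  (forall s u, 0 <= s -> s <= u -> f s <= f u) -> 1 <= t ->
  t * int0 f 1 <= int0 f t.
Proof.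
move=> cf ndf t1; have t0 : 0 <= t by exact: le_trans t1.
(* [g] is nonnegative from 1 on, so the integral of [f] grows by at least [(t - 1) * f 1] between 1
   and [t], and [f 1] is at least [int0 f 1]. *)
pose g s := f s - f 1.
have cc c : continuous (fun _ : R => c : R) by move=> s; exact: cvg_cst.
have cg : continuous g by move=> s; apply: cvgB; [exact: cf|exact: cvg_cst].
have g0 x : 1 <= x -> 0 <= g x by move=> x1; rewrite subr_ge0 ndf.
have := int0_mono_from cg ler01 g0 t1.
rewrite /g (int0B _ cf (cc _)) (int0B _ cf (cc _)) !int0_cst// mulr1.
have : int0 g 1 <= 0.
  rewrite /g (int0B _ cf (cc _)) int0_cst// mulr1 subr_le0.
  rewrite -[leRHS]mulr1 -int0_cst//.
  apply: le_Rintegral => //; try exact: continuous_integrable_itv.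
  by move=> s /=; rewrite in_itv/= => /andP[s0 s1]; exact: ndf.
rewrite /g (int0B _ cf (cc _)) int0_cst// mulr1.
set I1 := int0 f 1; set It := int0 f t; nra.
Qed.

Lemma int0_derive (R : realType) (F f : R -> R) t :
  (forall s : R, is_derive s 1 F (f s)) -> continuous f -> 0 < t ->
  int0 f t = F t - F 0.
Proof.
move=> dF cf t0; rewrite /int0 /Rintegral (@continuous_FTC2 _ f F)//.
- exact: continuous_subspaceT.
- have cF := is_derive1_continuous dF; split.
  + by move=> x _; have [] := dF x.
  + exact/cvg_at_right_filter/cF.
  + exact/cvg_at_left_filter/cF.
- by move=> x _; rewrite derive1E; have [_] := dF x.
Qed.

(** The partial integrals are nondecreasing and bounded, so they converge; the fundamental theorem
    of calculus on the half-line identifies the limit with the integral, whose finiteness gives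
    integrability. *)
Lemma ge0_int0_cvg (R : realType) (f : R -> R) M : continuous f ->
  (forall s, 0 <= f s) -> (forall t, 0 <= t -> int0 f t <= M) ->
  (@lebesgue_measure R).-integrable `[0, +oo[ (EFin \o f) /\
  int0 f t @[t --> +oo] --> \int[@lebesgue_measure R]_(s in `[0, +oo[) f s.
Proof.
move=> cf f0 fM; set F := int0 f.
have ndF : nondecreasing_fun F by move=> s t st; apply: int0_mono => // x _.
have ubF : has_ubound (range F).
  (* The bound [fM] is available at nonnegative times only, hence the passage from [t] to its
     absolute value. *)
  exists M => _ [t _ <-]; apply: le_trans (fM `|t| _) => //.
  by apply: ndF; exact: ler_norm.
have Fl := nondecreasing_cvgr ndF ubF; set l := sup _ in Fl.
have F0 : F 0 = 0 by rewrite /F /int0 set_itv1 Rintegral_set1.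
have dF x : 0 < x -> derivable F x 1 /\ derive1 F x = f x.
  move=> x0; apply: (@continuous_FTC1_closed _ f 0 x (x + 1)) => //.
  - by rewrite ltrDl.
  - exact: continuous_integrable_itv.
  - exact: cf.
have E : (\int[@lebesgue_measure R]_(s in `[0%R, +oo[) (f s)%:E = l%:E)%E.
  rewrite (@ge0_continuous_FTC2y _ f F 0 l)//.
  - by rewrite F0 sube0.
  - exact: continuous_subspaceT.
  - by move=> x /dF[].
  - rewrite F0; apply: cvg_at_right_filter.
    apply: (@parameterized_integral_cvg_left _ 0 1) => //.
    exact: continuous_integrable_itv.
  - by move=> x; rewrite in_itv/= andbT => /dF[].
split; last by rewrite /Rintegral E.
apply/integrableP; split.
  apply/measurable_EFinP; apply: measurable_funTS; exact: continuous_measurable_fun.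
under eq_integral do rewrite /= ger0_norm//.
by rewrite E ltry.
Qed.

(** Here [f] is the difference of the nonnegative functions [g + f] and [g], whose partial integrals
    are at most [M + M] and [M]. *)
Lemma dominated_int0_cvg (R : realType) (f g : R -> R) M : continuous f ->
  continuous g -> (forall s, `|f s| <= g s) ->
  (forall t, 0 <= t -> int0 g t <= M) ->
  (@lebesgue_measure R).-integrable `[0, +oo[ (EFin \o f) /\
  int0 f t @[t --> +oo] --> \int[@lebesgue_measure R]_(s in `[0, +oo[) f s.
Proof.
move=> cf cg fg gM.
have g0 s : 0 <= g s by apply: le_trans (fg s).
have [ig gl] := ge0_int0_cvg cg g0 gM.
have cgf : continuous (fun s : R => g s + f s).
  by move=> s; apply: cvgD; [exact: cg|exact: cf].
have [| |igf gfl] := @ge0_int0_cvg _ _ (M + M) cgf.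
- by move=> s; have := fg s; rewrite ler_norml => /andP[]; lra.
- move=> t t0; rewrite int0D// lerD ?gM//.
  apply: le_trans (gM _ t0); apply: le_int0 => // s _.
  by apply: le_trans (fg s); exact: ler_norm.
have fE : f = fun s => (g s + f s) - g s by apply/funext => s; lra.
split.
  have -> : EFin \o f = ((EFin \o (fun s => g s + f s)%R) \- (EFin \o g))%E.
    by apply/funext => s /=; rewrite -EFinB; congr EFin; lra.
  exact: integrableB.
have -> : int0 f = fun t => int0 (fun s => g s + f s) t - int0 g t.
  by apply/funext => t; rewrite int0D// addrC addKr.
rewrite [X in \int[_]_(s in _) X s]fE RintegralB//.
exact: cvgB.
Qed.

(** An energy estimate for [g = p ^+ 2 + q ^+ 2]. The terms in [b] are a rotation and cancel in
    [g']; half of the damping [2 * a * g] absorbs the cross terms with [h1] and [h2]. Integrating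
    and dropping [g t >= 0] bounds the integral of [g]. *)
Lemma damped_system_l2 (R : realType) (p q h1 h2 : R -> R) (a b M : R) : a < 0 ->
  (forall s : R, is_derive s 1 p (a * p s - b * q s + h1 s)) ->
  (forall s : R, is_derive s 1 q (b * p s + a * q s + h2 s)) ->
  continuous h1 -> continuous h2 ->
  (forall t, 0 <= t -> int0 (fun s => h1 s ^+ 2 + h2 s ^+ 2) t <= M) ->
  exists M', forall t, 0 <= t -> int0 (fun s => p s ^+ 2 + q s ^+ 2) t <= M'.
Proof.
move=> a0 dp dq ch1 ch2 hM.
have cp := is_derive1_continuous dp; have cq := is_derive1_continuous dq.
pose g s := p s ^+ 2 + q s ^+ 2.
pose g' s := 2 * a * g s + 2 * (p s * h1 s + q s * h2 s).
have dg (s : R) : is_derive s 1 g (g' s).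
  pose Hp := dp s; pose Hq := dq s.
  rewrite (_ : g = p * p + q * q); last by apply/funext => x; rewrite /g !expr2.
  apply: is_derive_eq; rewrite /g' /g -![_ *: _]/(_ * _).
  by ring.
have cX (f : R -> R) : continuous f -> continuous (fun s => f s ^+ 2).
  by move=> cf s; under eq_fun do rewrite expr2; apply: cvgM; exact: cf.
have cg : continuous g by exact: is_derive1_continuous dg.
have ch : continuous (fun s => h1 s ^+ 2 + h2 s ^+ 2).
  by move=> s; apply: cvgD; exact: cX.
have cg' : continuous g'.
  move=> s; apply: cvgD; first by apply: cvgMl_tmp; exact: cg.
  by apply: cvgMl_tmp; apply: cvgD; apply: cvgM; [exact: cp|exact: ch1|exact: cq|exact: ch2].
have H t : 0 < t -> - a * int0 g t <= g 0 + (- a)^-1 * M.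
  move=> t0; have := int0_derive dg cg' t0.
  have g0 : 0 <= g t by rewrite addr_ge0 ?sqr_ge0.
  have := hM _ (ltW t0).
  have ca : continuous (fun s => a * g s) by move=> s; apply: cvgMl_tmp; exact: cg.
  have cia : continuous (fun s => (- a)^-1 * (h1 s ^+ 2 + h2 s ^+ 2)).
    by move=> s; apply: cvgMl_tmp; exact: ch.
  have : int0 g' t <= int0 (fun s => a * g s + (- a)^-1 * (h1 s ^+ 2 + h2 s ^+ 2)) t.
    apply: le_int0 => //; first by move=> s; apply: cvgD; [exact: ca|exact: cia].
    (* AM-GM: [2 x h <= - a x^2 + h^2 / (- a)] *)
    have AMGM x h : 2 * (x * h) <= - a * x ^+ 2 + (- a)^-1 * h ^+ 2.
      rewrite -subr_ge0.
      have -> : - a * x ^+ 2 + (- a)^-1 * h ^+ 2 - 2 * (x * h) = (- a)^-1 * (a * x + h) ^+ 2.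
        by field; rewrite lt_eqF.
      by rewrite mulr_ge0 ?sqr_ge0// invr_ge0; lra.
    move=> s _; rewrite /g' /g.
    by have := AMGM (p s) (h1 s); have := AMGM (q s) (h2 s); lra.
  rewrite (int0D _ ca cia) (int0Z _ _ cg) (int0Z _ _ ch) => I1 I2 I3.
  have ia : 0 <= (- a)^-1 by rewrite invr_ge0; lra.
  have := ler_wpM2l ia I2; lra.
(* The maximum with 0 covers [t = 0], where the integral vanishes and [H] does not apply. *)
exists (Num.max 0 ((- a)^-1 * (g 0 + (- a)^-1 * M))) => t.
rewrite le_eqVlt => /predU1P[<-|/H Ht].
  by rewrite /int0 set_itv1 Rintegral_set1 le_max lexx.
rewrite le_max; apply/orP; right.
by rewrite mulrC ler_pdivlMr ?oppr_gt0// mulrC.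
Qed.

(** * Square integrability of the exponential *)

Lemma is_derive1_sum (R : realType) n (f : 'I_n -> R -> R) (d : 'I_n -> R) (s : R) :
  (forall i, is_derive s 1 (f i) (d i)) ->
  is_derive s 1 (fun s => \sum_i f i s) (\sum_i d i).
Proof.
move=> df; rewrite (_ : (fun s => _) = \sum_i f i).
  exact: is_derive_sum.
by apply/funext => x; rewrite fct_sumE.
Qed.

Lemma is_derive_mul_expm (R : realType) m n (X : 'M[R]_(m, n)) (B : 'M[R]_n) i j (s : R) :
  is_derive s 1 (fun s => (X *m expm (s *: B)) i j) ((X *m B *m expm (s *: B)) i j).
Proof.
rewrite -mulmxA (_ : (fun s => _) = fun s => \sum_k X i k * expm (s *: B) k j).
  rewrite mxE; apply: is_derive1_sum => k.
  have := is_derive_expm B k j s => H.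
  have := @is_deriveZ _ _ _ _ (X i k) _ _ _ H; exact.
by apply/funext => x; rewrite mxE.
Qed.

Lemma is_derive_expm_mul (R : realType) m n (B : 'M[R]_n) (X : 'M[R]_(n, m)) i j (s : R) :
  is_derive s 1 (fun s => (expm (s *: B) *m X) i j) ((expm (s *: B) *m (B *m X)) i j).
Proof.
have := is_derive_mul_expm X^T B^T j i s.
rewrite -trmx_mul expm_tr -trmx_mul mxE.
rewrite (_ : (fun s => (X^T *m expm (s *: B^T)) j i) = fun s => (expm (s *: B) *m X) i j)//.
by apply/funext => x; rewrite expm_tr -trmx_mul mxE.
Qed.

Lemma continuous_expm (R : realType) n (B : 'M[R]_n) i j :
  continuous (fun s : R => expm (s *: B) i j).
Proof. exact: is_derive1_continuous (is_derive_expm B i j). Qed.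

Local Notation RtoC := (map_mx (real_complex _)).
Local Notation Re := (@complex.Re _).
Local Notation Im := (@complex.Im _).

(** The fold removes one factor at a time, as the induction in [expm_l2_factors] needs, while the
    product on the right is the shape used by the Cayley-Hamilton theorem. The factors commute,
    being polynomials in [A]. *)
Lemma foldl_char_factors (F : fieldType) n (A : 'M[F]_n.+1) (r : seq F)
  (Z : 'M[F]_n.+1) :
  foldl (fun Z l => A *m Z - l *: Z) Z r =
  horner_mx A (\prod_(l <- r) ('X - l%:P)) *m Z.
Proof.
elim: r Z => [|l r IH] Z /=.
  by rewrite big_nil rmorph1 mul1mx.
rewrite IH big_cons mulrC rmorphM/= rmorphB/= horner_mx_X horner_mx_C.
by rewrite -mulmxA mulmxBl mul_scalar_mx.
Qed.

(** Induction on [r]. With [Z' = B Z - l Z], the function [u(s) = e^{sB} Z] solves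
    [u' = l u + e^{sB} Z'], whose forcing term is square integrable by induction; the real and
    imaginary parts form a system for [damped_system_l2]. When no factor is left, [Z] is 0. *)
Lemma expm_l2_factors (R : realType) n (B : 'M[R]_n) (r : seq R[i]) (Z : 'M[R[i]]_n) i j :
  (forall l, l \in r -> Re l < 0) ->
  foldl (fun Z l => RtoC B *m Z - l *: Z) Z r = 0 ->
  exists M, forall t, 0 <= t ->
    int0 (fun s => (expm (s *: B) *m map_mx Re Z) i j ^+ 2 +
                   (expm (s *: B) *m map_mx Im Z) i j ^+ 2) t <= M.
Proof.
elim: r Z => [|l r IH] Z rn /=.
  move=> ->; exists 0 => t t0.
  have -> : map_mx Re (0 : 'M[R[i]]_n) = 0 by apply/matrixP => k m; rewrite !mxE.
  have -> : map_mx Im (0 : 'M[R[i]]_n) = 0 by apply/matrixP => k m; rewrite !mxE.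
  rewrite /int0; under eq_Rintegral do rewrite mulmx0 mxE expr0n addr0.
  by rewrite Rintegral_cst// mul0r.
move=> /IH[|M HM]; first by move=> k kr; apply: rn; rewrite inE kr orbT.
have l0 : Re l < 0 by apply: rn; exact: mem_head.
set Z' := RtoC B *m Z - l *: Z in HM.
have ReZ' : map_mx Re Z' = B *m map_mx Re Z - Re l *: map_mx Re Z + Im l *: map_mx Im Z.
  apply/matrixP => k m; rewrite !mxE raddfB/= raddf_sum/=.
  rewrite (eq_bigr (fun p => B k p * (map_mx Re Z) p m)); last first.
    by move=> p _; rewrite !mxE; case: (Z p m) => u v /=; rewrite mul0r subr0.
  by case: (l) (Z k m) => lr li [u v] /=; ring.
have ImZ' : map_mx Im Z' = B *m map_mx Im Z - Re l *: map_mx Im Z - Im l *: map_mx Re Z.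
  apply/matrixP => k m; rewrite !mxE raddfB/= raddf_sum/=.
  rewrite (eq_bigr (fun p => B k p * (map_mx Im Z) p m)); last first.
    by move=> p _; rewrite !mxE; case: (Z p m) => u v /=; rewrite mul0r addr0.
  by case: (l) (Z k m) => lr li [u v] /=; ring.
have cE X : continuous (fun s : R => (expm (s *: B) *m X) i j).
  exact: is_derive1_continuous (is_derive_expm_mul B X i j).
apply: (@damped_system_l2 _ _ _ _ _ (Re l) (Im l) _ l0 _ _ (cE _) (cE _) HM) => s.
  apply: (is_derive_eq (is_derive_expm_mul B (map_mx Re Z) i j s)).
  rewrite ReZ' mulmxDr mulmxBr -!scalemxAr !mxE; ring.
apply: (is_derive_eq (is_derive_expm_mul B (map_mx Im Z) i j s)).
rewrite ImZ' !mulmxBr -!scalemxAr !mxE; ring.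
Qed.

(** Take [Z] to be the identity and [r] all roots of the characteristic polynomial: the fold
    vanishes by Cayley-Hamilton. *)
Lemma expm_l2 (R : realType) n (B : 'M[R]_n.+1) i j : spectral_abscissa B < 0 ->
  exists M, forall t, 0 <= t ->
    int0 (fun s => expm (s *: B) i j ^+ 2) t <= M.
Proof.
move=> B0; have [_ Bmax] := @spectral_abscissa_max R n.+1 B isT.
have [r Er] := closed_field_poly_normal (char_poly (RtoC B)).
rewrite (monicP (char_poly_monic _)) scale1r in Er.
have [||M HM] := @expm_l2_factors R n.+1 B r 1%:M i j.
- move=> l lr; apply: le_lt_trans B0; apply: Bmax.
  by rewrite /spectrum /= eigenvalue_root_char Er root_prod_XsubC.
- by rewrite foldl_char_factors -Er Cayley_Hamilton mul0mx.
exists M => t /HM; congr (_ <= _); apply: eq_Rintegral => s _.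
have -> : map_mx Re (1%:M : 'M[R[i]]_n.+1) = 1%:M.
  by apply/matrixP => k m; rewrite !mxE; case: (k == m).
have -> : map_mx Im (1%:M : 'M[R[i]]_n.+1) = 0.
  by apply/matrixP => k m; rewrite !mxE; case: (k == m).
by rewrite mulmx1 mulmx0 mxE expr0n addr0.
Qed.

(** * The Gram matrix *)

Lemma gram_integrandE (R : realType) n (Q B : 'M[R]_n) s i j :
  gram_integrand Q B s i j =
  \sum_k \sum_l expm (s *: B) i l * Q l k * expm (s *: B) j k.
Proof.
rewrite /gram_integrand expm_tr mxE; apply: eq_bigr => k _.
by rewrite !mxE mulr_suml.
Qed.

Lemma continuous_gram (R : realType) n (Q B : 'M[R]_n) i j :
  continuous (fun s : R => gram_integrand Q B s i j).
Proof.
under eq_fun do rewrite gram_integrandE.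
apply: continuousT_sum => k; apply: continuousT_sum => l s.
apply: cvgM; last exact: continuous_expm.
by apply: cvgMr_tmp; exact: continuous_expm.
Qed.

Lemma gram_integrand_cvg (R : realType) n (Q B : 'M[R]_n.+1) i j :
  spectral_abscissa B < 0 ->
  (@lebesgue_measure R).-integrable `[0, +oo[
    (fun s => (gram_integrand Q B s i j)%:E) /\
  int0 (fun s => gram_integrand Q B s i j) t @[t --> +oo] -->
    \int[@lebesgue_measure R]_(s in `[0, +oo[) gram_integrand Q B s i j.
Proof.
move=> B0.
pose e i k s : R := expm (s *: B) i k ^+ 2.
have ce p k : continuous (e p k).
  move=> s; rewrite /e; under eq_fun do rewrite expr2.
  by apply: cvgM; exact: continuous_expm.
(* Each term of the double sum in [gram_integrandE] is dominated by means of [|x y| <= x^2 + y^2],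
   which reduces integrability to [expm_l2]. *)
pose h k l s : R := `|Q l k| * (e i l s + e j k s).
have cee k l : continuous (fun s => e i l s + e j k s).
  by move=> s; apply: cvgD; exact: ce.
have ch k l : continuous (h k l) by move=> s; apply: cvgMl_tmp; exact: cee.
have hM k l : exists M, forall t, 0 <= t -> int0 (h k l) t <= M.
  have [M1 HM1] := expm_l2 i l B0; have [M2 HM2] := expm_l2 j k B0.
  exists (`|Q l k| * (M1 + M2)) => t t0.
  rewrite (int0Z _ _ (cee k l)) (int0D _ (ce i l) (ce j k)).
  by apply: ler_wpM2l => //; apply: lerD; [exact: HM1|exact: HM2].
pose g s := \sum_k \sum_l h k l s.
have cg : continuous g by apply: continuousT_sum => k; exact: continuousT_sum.
have {}hM k : exists M, forall l t, 0 <= t -> int0 (h k l) t <= M l.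
  by have [M HM] := choice (hM k); exists M.
have [M HM] := choice hM.
apply: (@dominated_int0_cvg _ _ g (\sum_k \sum_l M k l)) => //.
- exact: continuous_gram.
- move=> s; rewrite gram_integrandE; apply: le_trans (ler_norm_sum _ _ _) _.
  apply: ler_sum => k _; apply: le_trans (ler_norm_sum _ _ _) _.
  apply: ler_sum => l _; rewrite mulrAC mulrC normrM ler_wpM2l//.
  rewrite normrM /e -[in leRHS]real_normK ?num_real//.
  rewrite -[X in _ <= _ + X]real_normK ?num_real//.
  set x := `|_|; set y := `|_|.
  have x0 : 0 <= x by exact: normr_ge0.
  have y0 : 0 <= y by exact: normr_ge0.
  by have := sqr_ge0 (x - y); nra.
- move=> t t0; rewrite int0_sum; last by move=> k; exact: continuousT_sum.
  apply: ler_sum => k _; rewrite int0_sum//; apply: ler_sum => l _.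
  exact: HM.
Qed.

Lemma scaled_Kmx (R : realType) n (Q B : 'M[R]_n) t : 0 < t ->
  t *: Kmx Q B t = \matrix_(i, j) int0 (fun s => gram_integrand Q B s i j) t.
Proof. by move=> t0; rewrite /Kmx scalerA mulfV ?gt_eqF// scale1r. Qed.

Lemma qformE (F : pzRingType) n (M : 'M[F]_n) x :
  qform M x = \sum_j \sum_i x i 0 * M i j * x j 0.
Proof.
rewrite /qform mxE; apply: eq_bigr => j _; rewrite !mxE mulr_suml.
by apply: eq_bigr => i _; rewrite mxE.
Qed.

Lemma qform_gram (R : realType) n (Q B : 'M[R]_n) s x :
  qform (gram_integrand Q B s) x = qform Q ((x^T *m expm (s *: B))^T).
Proof. by rewrite /qform /gram_integrand expm_tr trmxK trmx_mul trmxK !mulmxA. Qed.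

Lemma continuous_qform_gram (R : realType) n (Q B : 'M[R]_n) x :
  continuous (fun s : R => qform (gram_integrand Q B s) x).
Proof.
under eq_fun do rewrite qformE.
apply: continuousT_sum => k; apply: continuousT_sum => l s.
by apply: cvgMr_tmp; apply: cvgMl_tmp; exact: continuous_gram.
Qed.

Lemma qform_scaled_Kmx (R : realType) n (Q B : 'M[R]_n) t x : 0 < t ->
  qform (t *: Kmx Q B t) x = int0 (fun s => qform (gram_integrand Q B s) x) t.
Proof.
move=> t0; rewrite scaled_Kmx// qformE.
have cG i j : continuous (fun s : R => x i 0 * gram_integrand Q B s i j * x j 0).
  by move=> s; apply: cvgMr_tmp; apply: cvgMl_tmp; exact: continuous_gram.
transitivity (int0 (fun s => \sum_j \sum_i x i 0 * gram_integrand Q B s i j * x j 0) t).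
  rewrite int0_sum; last by move=> k; apply: continuousT_sum => l; exact: cG.
  apply: eq_bigr => j _; rewrite int0_sum; last by move=> k; exact: cG.
  apply: eq_bigr => i _; rewrite mxE mulrAC -int0Z; last exact: continuous_gram.
  by apply: eq_Rintegral => s _; rewrite mulrAC.
by apply: eq_Rintegral => s _; rewrite qformE.
Qed.

Lemma qform_gram_ge0 (R : realType) n (Q B : 'M[R]_n) s x : psdmx Q ->
  0 <= qform (gram_integrand Q B s) x.
Proof. by move=> [_ Q0]; rewrite qform_gram; exact: Q0. Qed.

Lemma qform_scaled_Kmx_mono (R : realType) n (Q B : 'M[R]_n) s t x : psdmx Q ->
  0 < s -> s <= t -> qform (s *: Kmx Q B s) x <= qform (t *: Kmx Q B t) x.
Proof.
move=> Qpsd s0 st; rewrite !qform_scaled_Kmx ?(lt_le_trans s0)//.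
apply: int0_mono => //; first exact: continuous_qform_gram.
by move=> *; exact: qform_gram_ge0.
Qed.

Lemma tr_scaled_Kmx (R : realType) n (Q B : 'M[R]_n) t : psdmx Q -> 0 < t ->
  (t *: Kmx Q B t)^T = t *: Kmx Q B t.
Proof.
move=> [QT _] t0; rewrite scaled_Kmx//; apply/matrixP => i j; rewrite !mxE.
apply: eq_Rintegral => s _.
suff GT : (gram_integrand Q B s)^T = gram_integrand Q B s by rewrite -[in RHS]GT [RHS]mxE.
by rewrite /gram_integrand expm_tr !trmx_mul trmxK QT mulmxA.
Qed.

Lemma qformB (F : pzRingType) n (M M' : 'M[F]_n) x :
  qform (M - M') x = qform M x - qform M' x.
Proof. by rewrite /qform mulmxBr mulmxBl !mxE. Qed.

Lemma posdef_scaled_Kmx (R : realType) n (Q B : 'M[R]_n) t : psdmx Q ->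
  0 < t -> Kmx Q B t \in unitmx -> posdefmx (t *: Kmx Q B t).
Proof.
move=> Qpsd t0 Ku; apply: psd_unit_posdef.
- exact: tr_scaled_Kmx.
- move=> x; rewrite qform_scaled_Kmx//; apply: Rintegral_ge0 => s _.
  exact: qform_gram_ge0.
- by rewrite unitmxZ// unitfE gt_eqF.
Qed.

(** Eigenvectors are row vectors acting from the left, which suits the Gram forms: they depend on
    [x *m expm (s *: B)]. As [B] is real, the eigenvector equation splits into its real and
    imaginary parts. *)
Lemma eigen_real_parts (R : realType) n (B : 'M[R]_n) (l : R[i]) : spectrum B l ->
  exists x y : 'rV[R]_n, [/\ (x != 0) || (y != 0),
    x *m B = Re l *: x - Im l *: y & y *m B = Im l *: x + Re l *: y].
Proof.
move=> /eigenvalueP[v vB v0]; exists (map_mx Re v), (map_mx Im v).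
split.
- rewrite -negb_and; apply: contra v0 => /andP[/eqP/rowP v1 /eqP/rowP v2].
  apply/eqP/rowP => k; have := v1 k; have := v2 k; rewrite !mxE.
  by case: (v 0 k) => a b /= -> ->.
- apply/rowP => k; have /rowP/(_ k)/(congr1 (@complex.Re _)) := vB.
  rewrite !mxE raddf_sum/= => H.
  have -> : \sum_p (map_mx Re v) 0 p * B p k = Re (l * v 0 k).
    rewrite -H; apply: eq_bigr => p _; rewrite !mxE.
    by case: (v 0 p) => a b /=; rewrite mulr0 subr0.
  by case: (l) (v 0 k) => lr li [a b].
- apply/rowP => k; have /rowP/(_ k)/(congr1 (@complex.Im _)) := vB.
  rewrite !mxE raddf_sum/= => H.
  have -> : \sum_p (map_mx Im v) 0 p * B p k = Im (l * v 0 k).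
    rewrite -H; apply: eq_bigr => p _; rewrite !mxE.
    by case: (v 0 p) => a b /=; rewrite mulr0 add0r.
  by case: (l) (v 0 k) => lr li [a b] /=; rewrite addrC.
Qed.

(** Neither form need be monotone alone, since [b] rotates [x] into [y]; in the derivative of the
    sum the terms in [b] cancel for each pair of indices, leaving [2 * a] times the sum. *)
Lemma qform_gram_eigen_mono (R : realType) n (Q B : 'M[R]_n) (x y : 'rV[R]_n)
    (a b : R) : psdmx Q -> 0 <= a ->
  x *m B = a *: x - b *: y -> y *m B = b *: x + a *: y ->
  forall s t, 0 <= s -> s <= t ->
  qform (gram_integrand Q B s) x^T + qform (gram_integrand Q B s) y^T <=
  qform (gram_integrand Q B t) x^T + qform (gram_integrand Q B t) y^T.
Proof.
move=> Qpsd a0 xB yB.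
pose p j (s : R) := (x *m expm (s *: B)) 0 j.
pose q j (s : R) := (y *m expm (s *: B)) 0 j.
have dp j (s : R) : is_derive s 1 (p j) (a * p j s - b * q j s).
  apply: (is_derive_eq (is_derive_mul_expm x B 0 j s)).
  by rewrite /p /q xB mulmxBl -!scalemxAl !mxE.
have dq j (s : R) : is_derive s 1 (q j) (b * p j s + a * q j s).
  apply: (is_derive_eq (is_derive_mul_expm y B 0 j s)).
  by rewrite /p /q yB mulmxDl -!scalemxAl !mxE.
pose f s := qform (gram_integrand Q B s) x^T + qform (gram_integrand Q B s) y^T.
have fE s : f s = \sum_j \sum_i Q i j * (p i s * p j s + q i s * q j s).
  rewrite /f !qform_gram !trmxK !qformE -big_split; apply: eq_bigr => j _ /=.
  by rewrite -big_split; apply: eq_bigr => i _ /=; rewrite /p /q !mxE; ring.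
have df (s : R) : is_derive s 1 f (2 * a * f s).
  rewrite (_ : f = fun s => \sum_j \sum_i Q i j * (p i s * p j s + q i s * q j s)); last first.
    by apply/funext => z; rewrite fE.
  rewrite mulr_sumr; apply: is_derive1_sum => j.
  rewrite mulr_sumr; apply: is_derive1_sum => i.
  pose dpi := dp i s; pose dpj := dp j s; pose dqi := dq i s; pose dqj := dq j s.
  have Hp := @is_deriveM _ _ _ _ _ _ _ _ dpi dpj.
  have Hq := @is_deriveM _ _ _ _ _ _ _ _ dqi dqj.
  have H := @is_deriveZ _ _ _ _ (Q i j) _ _ _ (@is_deriveD _ _ _ _ _ _ _ _ _ Hp Hq).
  apply: (is_derive_eq H); rewrite -![_ *: _]/(_ * _); ring.
have f0 s : 0 <= f s by apply: addr_ge0; exact: qform_gram_ge0.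
move=> s t s0 st; apply: (@ger0_derive1_ndecry _ f 0) => //.
- move=> z _; rewrite derive1E; have [_ ->] := df z.
  by apply: mulr_ge0; [exact: mulr_ge0|exact: f0].
- by apply: continuous_subspaceT; exact: is_derive1_continuous df.
Qed.

(** * The volume of the unit ball *)

Lemma measurable_unit_ball (R : realType) n : measurable (@unit_ball R n).
Proof.
have mf : measurable_fun [set: n.-tuple (measurableTypeR R)]
    (fun v : n.-tuple (measurableTypeR R) => \sum_(i < n) (tnth v i : R) ^+ 2).
  apply: measurable_sum => i; apply: measurable_funX; exact: measurable_tnth.
have := mf measurableT `]-oo, 1[%classic (measurable_itv _).
rewrite setTI; congr measurable; apply/seteqP; split => v /=;
  by rewrite /unit_ball /= in_itv.
Qed.

Lemma lebesgue_tuple_cube (R : realType) n (r : R) : 0 <= r ->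
  lebesgue_tuple [set v : n.-tuple (measurableTypeR R) |
    forall i, `[- r, r]%classic (tnth v i)] = ((r *+ 2) ^+ n)%:E.
Proof.
move=> r0; rewrite (@lebesgue_tuple_box R n (fun=> `[- r, r]%classic))//.
rewrite (eq_bigr (fun=> (r *+ 2)%:E)) => [|i _].
  by rewrite prodEFin prodr_const card_ord.
rewrite lebesgue_measure_itv/= lte_fin -EFinB opprK mulr2n.
by case: ltP => // h; congr EFin; lra.
Qed.

(** [omega] is a [fine] value, which would be 0 for an infinite measure, so the ball must be shown
    to have positive and finite measure. It lies between two cubes. *)
Lemma omega_gt0 (R : realType) n : 0 < omega R n.
Proof.
have [mu muE] := lebesgue_tuple_measure R n.
pose cube (r : R) := [set v : n.-tuple (measurableTypeR R) |
    forall i, `[- r, r]%classic (tnth v i)].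
have mcube r : measurable (cube r).
  rewrite [X in measurable X](_ : _ = \bigcap_(i : 'I_n) ((@tnth n _)^~ i @^-1` `[-r, r]%classic)).
    apply: fin_bigcap_measurable => // i _.
    by rewrite -[X in measurable X]setTI; exact: measurable_tnth.
  by apply/seteqP; split => v /= h i; [move=> _; exact: h | exact: h].
have sub1 : @unit_ball R n `<=` cube 1.
  move=> v; rewrite /unit_ball /= => v1 i; rewrite /= in_itv/= -ler_norml.
  rewrite -ler_sqr ?nnegrE// real_normK ?num_real// expr1n.
  apply: le_trans (ltW v1).
  by rewrite (bigD1 i)//= lerDl sumr_ge0// => j _; exact: sqr_ge0.
(* A point of [cube r] has squared norm at most [n / (n + 1)^2], which is below 1 also for
   [n = 0]. *)
pose r : R := n.+1%:R^-1.
have r0 : 0 < r by rewrite invr_gt0.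
have sub2 : cube r `<=` @unit_ball R n.
  move=> v vr; rewrite /unit_ball /=.
  apply: (@le_lt_trans _ _ (\sum_(i < n) r ^+ 2)).
    apply: ler_sum => i _; have := vr i; rewrite /= in_itv/= -ler_norml => h.
    by rewrite -real_normK ?num_real// ler_sqr ?nnegrE// ltW.
  rewrite sumr_const card_ord -mulr_natl.
  apply: (@lt_le_trans _ _ (n.+1%:R * r ^+ 2)).
    by rewrite ltr_pM2r ?exprn_gt0// ltr_nat.
  by rewrite expr2 mulrA mulfV// mul1r invf_le1// ler1n.
rewrite /omega fine_gt0//; apply/andP; split.
  apply: (@lt_le_trans _ _ (lebesgue_tuple (cube r))).
    by rewrite lebesgue_tuple_cube ?ltW// lte_fin exprn_gt0// mulrn_wgt0.
  rewrite muE le_measure// inE//; exact: measurable_unit_ball.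
apply: (@le_lt_trans _ _ (lebesgue_tuple (cube 1))).
  rewrite muE le_measure// inE//; exact: measurable_unit_ball.
by rewrite lebesgue_tuple_cube// ltry.
Qed.

(** * The volume function *)

Theorem proposition2p3 (R : realType) (N : nat) (Q B : 'M[R]_N)
  (N_gt0 : (0 < N)%N)
  (Q_psd : psdmx Q)
  (K_inv : forall t : R, 0 < t -> Kmx Q B t \in unitmx) :
  (0 <= spectral_abscissa B ->
     exists c0 : R, 0 < c0 /\
       forall t : R, 1 <= t -> c0 * Num.sqrt t <= volume Q B t) /\
  (spectral_abscissa B < 0 ->
     [/\ mx_integrable `[0, +oo[ (gram_integrand Q B),
         (fun t : R => t *: Kmx Q B t) @ +oo --> Kmx_infty Q B &
         forall s t : R, 0 < s -> s <= t ->
           loewner_le (s *: Kmx Q B s) (t *: Kmx Q B t)]).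
Proof.
case: N => [//|n] in Q B N_gt0 Q_psd K_inv *.
split=> [B0|B0]; last first.
  split.
  - by move=> i j; have [] := gram_integrand_cvg Q i j B0.
  - apply: cvg_mx => i j; rewrite mxE.
    have [_] := gram_integrand_cvg Q i j B0.
    (* The factor [t^-1] in [Kmx] cancels for [t > 0], hence the identification for large [t]
       only. *)
    apply: cvg_trans; apply: near_eq_cvg; near=> t.
    by rewrite scaled_Kmx ?mxE//; near: t; exact: nbhs_pinfty_gt.
  - move=> s t s0 st; have t0 := lt_le_trans s0 st; split.
      by rewrite linearB/= !tr_scaled_Kmx.
    move=> x; rewrite -/(qform _ x) qformB subr_ge0.
    exact: qform_scaled_Kmx_mono.
pose C t := t *: Kmx Q B t.
have Cpd t : 0 < t -> posdefmx (C t).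
  by move=> t0; apply: posdef_scaled_Kmx => //; exact: K_inv.
have [[l sl lE] _] := spectral_abscissa_max B N_gt0.
have [x [y [xy0 xB yB]]] := eigen_real_parts sl.
rewrite -lE in B0.
have [cx cx0 detx] := det_ge_qform x^T (Cpd 1 ltr01).
have [cy cy0 dety] := det_ge_qform y^T (Cpd 1 ltr01).
pose q := qform (C 1) x^T + qform (C 1) y^T.
(* The real or the imaginary part of the eigenvector is nonzero, and [C 1] is positive definite. *)
have q0 : 0 < q.
  have [_ C1] := Cpd 1 ltr01.
  have nz (z : 'rV[R]_n.+1) : z != 0 -> 0 < qform (C 1) z^T.
    move=> z0; apply: C1; apply: contra z0 => /eqP/(congr1 trmx).
    by rewrite trmxK trmx0 => ->.
  have ge0 z := posdefmx_ge0 z (Cpd 1 ltr01).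
  by case/orP: xy0 => /nz; [exact: ltr_wpDr|exact: ltr_wpDl].
have qt t : 1 <= t -> t * q <= qform (C t) x^T + qform (C t) y^T.
  move=> t1; have t0 : 0 < t by exact: lt_le_trans t1.
  rewrite /q /C !qform_scaled_Kmx// -!int0D; try exact: continuous_qform_gram.
  apply: int0_nondecreasing_ge => //.
    by move=> s; apply: cvgD; exact: continuous_qform_gram.
  exact: (qform_gram_eigen_mono Q_psd B0 xB yB).
(* Adding the two determinant bounds gives [t * q <= (cx^-1 + cy^-1) * \det (C t)]. *)
pose c := q / (cx^-1 + cy^-1).
have cc0 : 0 < cx^-1 + cy^-1 by rewrite addr_gt0 ?invr_gt0.
have c0 : 0 < c by rewrite divr_gt0.
have det_ge t : 1 <= t -> c * t <= \det (C t).
  move=> t1; have t0 : 0 < t by exact: lt_le_trans t1.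
  have C1t z : qform (C 1) z <= qform (C t) z by exact: qform_scaled_Kmx_mono.
  rewrite /c mulrAC ler_pdivrMr// mulrC; apply: le_trans (qt _ t1) _.
  rewrite mulrDr; apply: lerD; rewrite ler_pdivlMr// mulrC.
    exact: detx (Cpd _ t0) C1t.
  exact: dety (Cpd _ t0) C1t.
exists (omega R n.+1 * Num.sqrt c); split.
  by rewrite mulr_gt0 ?omega_gt0// sqrtr_gt0.
move=> t t1; rewrite /volume -mulrA ler_pM2l ?omega_gt0// -sqrtrM ?(ltW c0)//.
by apply: ler_wsqrtr; exact: det_ge.
Unshelve. all: by end_near. Qed.
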